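(* Let $m,n\in\mathbb{Z}$ with $\sqrt{m+ni}\notin\mathbb{Q}(i)$, where $\sqrt{m+ni}$ is a complex square root of $m+ni$. Let $\alpha=\sqrt{m+ni}-\lfloor\sqrt{m+ni}\rfloor_H$. Then the sequence $(\alpha^H_{(n)})$ produced from $\alpha$ by J. Hurwitz's algorithm is purely periodic.
   Context: Let $X=\{u(1+i)+v(1-i): -1/2\le u,v<1/2\}$, $\overline X$ its closure, $X^o$ its interior. For $0\le k<4$ set $L(i^k(1+i))=i^k(1+i)\mathbb{Z}_{>0}$, $L(i^k2)=\{i^k(m(1+i)+l(1-i)): m,l\in\mathbb{Z}_{>0}\}$. For $w\in(1+i)\mathbb{Z}[i]$: $Q_0=\overline X$; if $w\in L(i^k(1+i))$, $Q_w=(X^o+w)\cup\{ui^k(1+i)-\tfrac12 i^k(1-i)+w: -\tfrac12<u\le\tfrac12\}\cup\{\tfrac12 i^k(1+i)+ui^k(1-i)+w: -\tfrac12\le u\le\tfrac12\}\cup\{ui^k(1+i)+\tfrac12 i^k(1-i)+w: -\tfrac12<u\le\tfrac12\}$; if $w\in L(i^k2)$, $Q_w=(X^o+w)\cup\{ui^k(1+i)+\tfrac12 i^k(1-i)+w: -\tfrac12<u\le\tfrac12\}\cup\{\tfrac12 i^k(1+i)+ui^k(1-i)+w: -\tfrac12<u\le\tfrac12\}$. These partition $\mathbb{C}$; for $z\notin\mathbb{Z}[i]$, $\lfloor z\rfloor_H$ is the unique $w$ with $z\in Q_w$, and $\lfloor z\rfloor_H=z$ for $z\in\mathbb{Z}[i]$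 (so here $\alpha\in\overline X$). $T_H(z)=1/z-\lfloor1/z\rfloor_H$ for $z\ne0$, $T_H(0)=0$. J. Hurwitz's algorithm: $\alpha^H_{(1)}=\alpha$; if $\alpha^H_{(n)}\ne0$ then $\alpha^H_{(n+1)}=T_H(\alpha^H_{(n)})$; if $\alpha^H_{(n)}=0$ the sequence terminates. Purely periodic means the sequence is infinite and there is $l\ge1$ with $\alpha^H_{(n+l)}=\alpha^H_{(n)}$ for all $n\ge1$. *)

(* Defs.v *)
From HB Require Import structures.
From mathcomp Require Import all_boot all_order all_algebra.
From mathcomp Require Export complex.
From mathcomp Require Import all_classical all_reals topology normedtype.
Import numFieldNormedType.Exports.
Import Order.TTheory GRing.Theory Num.Theory.

Set Implicit Arguments.
Unset Strict Implicit.
Unset Printing Implicit Defensive.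

Local Open Scope classical_set_scope.
Local Open Scope complex_scope.
Local Open Scope ring_scope.

(* R[i] seen as a numClosedFieldType, so that it receives the topology that
   MathComp-Analysis puts on every number field (here: the usual topology of
   the complex plane). *)
Definition CC (R : realType) : numClosedFieldType := R[i].

Section JHurwitz.
Variable R : realType.
Local Notation C := (CC R).

Definition gauss_int : set C :=
  [set z | exists a b : int, z = a%:~R +i* b%:~R].

Definition gauss_rat : set C :=
  [set z | exists p q : rat, z = ratr p +i* ratr q].

Definition onePi : C := 1 +i* 1.
Definition oneMi : C := 1 -i* 1.
Definition iC : C := 0 +i* 1.

Definition hlattice : set C := [set onePi * z | z in gauss_int].

(* The point with coordinates (u, v) in the basis i^k(1 + i), i^k(1 - i). *)
Definition pt (k : nat) (u v : R) : C :=
  u%:C * (iC ^+ k * onePi) + v%:C * (iC ^+ k * oneMi).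

Definition half : R := 2^-1.

Definition Xsq : set C :=
  [set z | exists u v : R,
     [/\ - half <= u < half, - half <= v < half
       & z = u%:C * onePi + v%:C * oneMi]].

(* L(i^k(1 + i)) and L(2 i^k). *)
Definition Lray (k : nat) : set C :=
  [set w | exists2 m : int, 0 < m & w = iC ^+ k * onePi * m%:~R].

Definition Lsector (k : nat) : set C :=
  [set w | exists m l : int,
     [/\ 0 < m, 0 < l & w = iC ^+ k * (m%:~R * onePi + l%:~R * oneMi)]].

Definition shift (A : set C) (w : C) : set C := [set z + w | z in A].

Definition Qray (k : nat) (w : C) : set C :=
  shift (interior Xsq) w
  `|` [set pt k u (- half) + w | u in [set u : R | - half < u <= half]]
  `|` [set pt k half u + w | u in [set u : R | - half <= u <= half]]
  `|` [set pt k u half + w | u in [set u : R | - half < u <= half]].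

Definition Qsector (k : nat) (w : C) : set C :=
  shift (interior Xsq) w
  `|` [set pt k u half + w | u in [set u : R | - half < u <= half]]
  `|` [set pt k half u + w | u in [set u : R | - half < u <= half]].

(* The three clauses are mutually exclusive, k is determined by w, and every
   w in (1 + i)Z[i] falls under one of them; so this is the piecewise
   definition of Q_w. *)
Definition Qcell (w : C) : set C :=
  [set z | [\/ w = 0 /\ closure Xsq z,
               exists k : nat, [/\ (k < 4)%N, Lray k w & Qray k w z]
             | exists k : nat, [/\ (k < 4)%N, Lsector k w & Qsector k w z]]].

(* The cells Q_w, w in (1 + i)Z[i], partition the plane, so that xget returns
   the unique w with z in Q_w; its default value 0 is never used. *)
Definition hfloor (z : C) : C :=
  if `[< gauss_int z >] then z else xget 0 [set w | hlattice w /\ Qcell w z].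

Definition TH (z : C) : C := if z == 0 then 0 else z^-1 - hfloor z^-1.

(* hseq alpha n is the term of index n.+1 of the sequence, the first one being
   alpha itself; None means that the sequence has already terminated. *)
Fixpoint hseq (alpha : C) (n : nat) : option C :=
  if n is n'.+1 then
    if hseq alpha n' is Some z then if z == 0 then None else Some (TH z)
    else None
  else Some alpha.

Definition infinite_seq (s : nat -> option C) : Prop :=
  forall n : nat, s n <> None.

Definition purely_periodic (s : nat -> option C) : Prop :=
  infinite_seq s /\
  exists2 l : nat, (1 <= l)%N & forall n : nat, s (n + l)%N = s n.

End JHurwitz.

(* Main.v *)
(** Write z' for the conjugate of a complete quotient z, obtained by replacing
    s = sqrt(m + ni) by - s, and let c range over the corners (+-1 +- i).  The
    pairs (z, z') that occur are "reduced": z is interior to the square X,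
    |z'| > 1, and |z' + c| >= 1 as soon as z lies in the closed disk with
    diameter [0, - c].  On reduced pairs the natural extension
    (z, z') |-> (1/z - a, 1/z' - a) with a = floor(1/z) is well defined and
    injective, and since s satisfies the same quadratic equation throughout,
    only finitely many pairs occur; an injective self-map of a finite set is
    periodic.

    Ties never matter: if z lies on a line over Q then, s^2 being a Gaussian
    integer, z' lies on the same line, and this keeps 1/z off the edges of the
    cells.  Similarly |z'| = 1 would force |z| = 1.

    X has its vertices on the unit circle, so z and z' could a priori both come
    close to a vertex u, with unbounded leading coefficient A.  But
    A (u - z) (u - z') is a nonzero Gaussian integer, which bounds
    1/(1 - z/u) - 1/(1 - z'/u) and keeps z away from u. *)
Require Import Defs.
From HB Require Import structures.
From mathcomp Require Import all_boot all_order all_algebra.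
From mathcomp Require Import complex.
From mathcomp Require Import all_classical all_reals topology normedtype.
From mathcomp Require Import ring lra zify.
Import numFieldNormedType.Exports.
Import Order.TTheory GRing.Theory Num.Theory.

Set Implicit Arguments.
Unset Strict Implicit.
Unset Printing Implicit Defensive.

Local Open Scope complex_scope.
Local Open Scope ring_scope.

Local Notation re := (@complex.Re _).
Local Notation im := (@complex.Im _).

(** * Coordinates and the even Gaussian lattice *)

Section Coordinates.
Variable R : realType.
Local Notation C := (CC R).
Implicit Types z w c : C.

Definition nsq z : R := re z ^+ 2 + im z ^+ 2.
Definition dot z w : R := re z * re w + im z * im w.

Lemma complex_eq z w : re z = re w -> im z = im w -> z = w.
Proof. by case: z w => [? ?] [? ?] /= -> ->. Qed.

Lemma reD z w : re (z + w) = re z + re w. Proof. by case: z; case: w. Qed.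
Lemma imD z w : im (z + w) = im z + im w. Proof. by case: z; case: w. Qed.
Lemma reN z : re (- z) = - re z. Proof. by case: z. Qed.
Lemma imN z : im (- z) = - im z. Proof. by case: z. Qed.
Lemma reM z w : re (z * w) = re z * re w - im z * im w.
Proof. by case: z; case: w. Qed.
Lemma imM z w : im (z * w) = re z * im w + im z * re w.
Proof. by case: z; case: w. Qed.
Lemma reV z : re z^-1 = re z / nsq z. Proof. by case: z. Qed.
Lemma imV z : im z^-1 = - im z / nsq z. Proof. by case: z => x y; rewrite mulNr. Qed.
Lemma reJ z : re (conjc z) = re z. Proof. by case: z. Qed.
Lemma imJ z : im (conjc z) = - im z. Proof. by case: z. Qed.

Definition coordE := (reD, imD, reN, imN, reM, imM, reJ, imJ).

Lemma nsq_ge0 z : 0 <= nsq z.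
Proof. by rewrite addr_ge0 ?sqr_ge0. Qed.

Lemma nsq_eq0 z : (nsq z == 0) = (z == 0).
Proof.
apply/eqP/eqP => [|->]; last by rewrite /nsq /= !expr0n addr0.
move/eqP; rewrite paddr_eq0 ?sqr_ge0 // !sqrf_eq0 => /andP[/eqP h1 /eqP h2].
exact: complex_eq.
Qed.

Lemma nsq_gt0 z : (0 < nsq z) = (z != 0).
Proof. by rewrite lt_neqAle nsq_ge0 andbT eq_sym nsq_eq0. Qed.

Lemma nsqM z w : nsq (z * w) = nsq z * nsq w.
Proof. rewrite /nsq !coordE; ring. Qed.

Lemma nsqN z : nsq (- z) = nsq z.
Proof. rewrite /nsq !coordE; ring. Qed.

Lemma nsqJ z : nsq (conjc z) = nsq z.
Proof. rewrite /nsq !coordE; ring. Qed.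

Lemma nsqV z : nsq z^-1 = (nsq z)^-1.
Proof.
have [->|z0] := eqVneq z 0; first by rewrite invr0 /nsq /= expr0n addr0 invr0.
apply: (@mulfI _ (nsq z)); first by rewrite nsq_eq0.
by rewrite -nsqM !mulfV ?nsq_eq0 // /nsq /= expr0n expr1n addr0.
Qed.

Lemma nsqB z w : nsq (z - w) = nsq z - 2 * dot w z + nsq w.
Proof. rewrite /nsq /dot !coordE; ring. Qed.

Lemma dotBr c z w : dot c (z - w) = dot c z - dot c w.
Proof. rewrite /dot !coordE; ring. Qed.

Lemma dotNl c z : dot (- c) z = - dot c z.
Proof. rewrite /dot !coordE; ring. Qed.

Lemma dotDr c z w : dot c (z + w) = dot c z + dot c w.
Proof. rewrite /dot !coordE; ring. Qed.

Lemma dotzz z : dot z z = nsq z.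
Proof. rewrite /nsq /dot; ring. Qed.

Lemma dotE c z : dot c z = re (conjc c * z).
Proof. rewrite /dot !coordE; ring. Qed.

Lemma dotV c z : dot c z^-1 = dot (conjc c) z / nsq z.
Proof. by rewrite /dot reV imV !coordE; ring. Qed.

Lemma dot_sqr_le z w : dot z w ^+ 2 <= nsq z * nsq w.
Proof.
have -> : nsq z * nsq w = dot z w ^+ 2 + (re z * im w - im z * re w) ^+ 2.
  by rewrite /nsq /dot; ring.
by rewrite lerDl sqr_ge0.
Qed.

(** The triangle inequality [|w| - |z| > 1], worked out with squares in place of moduli. *)
Lemma nsq_sub_gt1 z w : nsq z < 1 -> 4 <= nsq w -> 1 < nsq (z - w).
Proof.
move=> z1 w4; rewrite nsqB ltNge; apply/negP => h.
have := dot_sqr_le w z; have := nsq_ge0 z.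
set V := nsq w in h w4 *; set U := nsq z in h z1 *; set D := dot w z in h *.
move=> U0 cs.
have h2 : (V + U - 1) ^+ 2 <= 4 * D ^+ 2.
  have : (V + U - 1) * (V + U - 1) <= (2 * D) * (2 * D) by apply: ler_pM; lra.
  by rewrite -!expr2 exprMn -natrX.
nra.
Qed.

Definition corner c : Prop := re c ^+ 2 = 1 /\ im c ^+ 2 = 1.

Lemma nsq_corner c : corner c -> nsq c = 2.
Proof. by case=> h1 h2; rewrite /nsq h1 h2. Qed.

Lemma cornerN c : corner c -> corner (- c).
Proof. by case=> h1 h2; split; rewrite !coordE sqrrN. Qed.

Lemma cornerJ c : corner c -> corner (conjc c).
Proof. by case=> h1 h2; split; rewrite !coordE ?sqrrN. Qed.

Lemma sqr_eq1_cases (x : R) : x ^+ 2 = 1 -> x = 1 \/ x = -1.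
Proof. by move/eqP; rewrite sqrf_eq1 => /orP[] /eqP; [left|right]. Qed.

(** Matching the signs of [c] to those of [z] gives [dot c z = |re z| + |im z|], whose square
    dominates [nsq z]. *)
Lemma corner_dot_ge z : exists2 c, corner c & 0 <= dot c z /\ nsq z <= dot c z ^+ 2.
Proof.
exists ((if 0 <= re z then 1 else -1) +i* (if 0 <= im z then 1 else -1)).
  by split => /=; case: ifP => _; rewrite ?sqrrN expr1n.
rewrite /dot /nsq /=; case: (leP 0 (re z)) => hx; case: (leP 0 (im z)) => hy; split; try lra.
- have := mulr_ge0 hx hy; lra.
- have := mulr_ge0_le0 hx (ltW hy); lra.
- have := mulr_le0_ge0 (ltW hx) hy; lra.
- have := mulr_le0 (ltW hx) (ltW hy); lra.
Qed.

(** The interior of [Xsq] as four open half-planes: the square has vertices 1, -1, i, -i, and its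
    edges are normal to the corners. *)
Definition in_square z : Prop := forall c, corner c -> dot c z < 1.

Lemma in_square_nsq z : in_square z -> nsq z < 1.
Proof.
move=> h; have [c cc [h0 h1]] := corner_dot_ge z; have := h c cc; nra.
Qed.

Lemma hlattice_coord w : hlattice w ->
  exists p q : int, re w = (p - q)%:~R /\ im w = (p + q)%:~R.
Proof.
case=> _ [p [q ->]] <-; exists p, q; split; rewrite ?reM ?imM /=; ring.
Qed.

Lemma hlatticeP w (p q : int) :
  re w = (p - q)%:~R -> im w = (p + q)%:~R -> hlattice w.
Proof.
move=> h1 h2; exists (p%:~R +i* q%:~R); first by exists p, q.
by apply: complex_eq; rewrite ?reM ?imM ?h1 ?h2 /=; ring.
Qed.

Lemma hlatticeB w1 w2 : hlattice w1 -> hlattice w2 -> hlattice (w1 - w2).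
Proof.
move=> /hlattice_coord [p [q [h1 h2]]] /hlattice_coord [p' [q' [h1' h2']]].
by apply: (@hlatticeP _ (p - p') (q - q')); rewrite !coordE ?h1 ?h2 ?h1' ?h2'; ring.
Qed.

Lemma corner_hlattice c : corner c -> hlattice c.
Proof.
case=> /sqr_eq1_cases h1 /sqr_eq1_cases h2.
by case: h1 => h1; case: h2 => h2;
 [apply: (@hlatticeP _ 1 0)|apply: (@hlatticeP _ 0 (-1))
 |apply: (@hlatticeP _ 0 1)|apply: (@hlatticeP _ (-1) 0)];
 rewrite ?h1 ?h2; ring.
Qed.

(** For [w = (1 + i)(p + q i)] the norm is [2 (p^2 + q^2)], so it is 0, 2 or at least 4, and 2
    occurs only at corners. The case analyses on translations rest on this. *)
Lemma hlattice_cases w : hlattice w -> [\/ w = 0, corner w | 4 <= nsq w].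
Proof.
case/hlattice_coord => p [q [h1 h2]].
have : [\/ (p = 0 /\ q = 0), (p - q) ^+ 2 = 1 /\ (p + q) ^+ 2 = 1
        | 4 <= (p - q) ^+ 2 + (p + q) ^+ 2].
  have [hp|hp] := leP 2 `|p|; first by constructor 3; nia.
  have [hq|hq] := leP 2 `|q|; first by constructor 3; nia.
  have : p = 0 \/ p = 1 \/ p = -1 by lia.
  have : q = 0 \/ q = 1 \/ q = -1 by lia.
  by move=> [->|[->|->]] [->|[->|->]];
     do ?[by constructor 1|by constructor 2|by constructor 3].
case=> [[p0 q0]|[e1 e2]|h]; [constructor 1|constructor 2|constructor 3].
- by apply: complex_eq; rewrite ?h1 ?h2 p0 q0.
- by split; rewrite ?h1 ?h2 -rmorphXn /= ?e1 ?e2.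
- by rewrite /nsq h1 h2 -!rmorphXn -rmorphD /= (ler_int R 4).
Qed.

End Coordinates.

(** * Reduced pairs *)

Section NaturalExtension.
Variable R : realType.
Local Notation C := (CC R).
Implicit Types z w c a : C.

Definition reduced z z' : Prop :=
  [/\ in_square z, 1 < nsq z'
    & forall c, corner c -> nsq z + dot c z <= 0 -> 1 <= nsq (z' + c)].

(** The image of [reduced] under inversion. The first clause puts [w] outside the closed disks with
    diameter [[0, c]], which are, up to conjugation, the inverses of the half-planes
    [dot c z >= 1]. *)
Definition coreduced w w' : Prop :=
  [/\ forall c, corner c -> dot c w < nsq w, nsq w' < 1
    & forall c, corner c -> nsq (w' - c) < 1 -> dot c w < 1].

(** Inversion turns the edge lines of the square into circles through 0. Since [nsq c = 2], the unit
    circle about a corner is orthogonal to the one about 0, so inversion carries it to the unit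
    circle about the conjugate corner. *)
Lemma reducedV z z' : z != 0 -> reduced z z' -> coreduced z^-1 z'^-1.
Proof.
move=> z0 [h1 h2 h3].
have z'0 : z' != 0 by rewrite -nsq_gt0; lra.
have n0 : 0 < nsq z by rewrite nsq_gt0.
split=> [c cc||c cc].
- by rewrite dotV nsqV ltr_pdivrMr // mulVf ?nsq_eq0 // h1 //; apply: cornerJ.
- by rewrite nsqV invf_lt1 ?nsq_gt0.
rewrite nsqB dotV nsqV dotV (nsq_corner cc) ltr_pdivrMr // mul1r => h.
rewrite ltNge; apply/negP => h'.
have /h3 : corner (- conjc c) by exact/cornerN/cornerJ.
rewrite dotNl nsqB nsqJ (nsq_corner cc) => /(_ ltac:(lra)).
have n'0 : 0 < nsq z' by lra.
have : nsq z' * ((nsq z')^-1 - 2 * (dot (conjc c) z' / nsq z') + 2) < nsq z' * 1.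
  by rewrite ltr_pM2l.
have -> : nsq z' * ((nsq z')^-1 - 2 * (dot (conjc c) z' / nsq z') + 2) =
   1 - 2 * dot (conjc c) z' + 2 * nsq z' by field; rewrite gt_eqF.
lra.
Qed.

(** The product of two corners is 2, 0 or -2, the last only when they are opposite. *)
Lemma corner_dot_ge0 c d : corner c -> corner d -> c + d != 0 -> 0 <= dot d c.
Proof.
move=> cc cd; apply: contra_neqP => /negP; rewrite -ltNge => h.
case: cc => /sqr_eq1_cases h1 /sqr_eq1_cases h2.
case: cd => /sqr_eq1_cases h3 /sqr_eq1_cases h4.
apply: complex_eq; rewrite !coordE /=; move: h; rewrite /dot;
by case: h1 => ->; case: h2 => ->; case: h3 => ->; case: h4 => ->; lra.
Qed.

(** Both norm bounds measure the distance from [w'], in the unit disk, to a lattice point, [a] or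
    [a - c]. Points of norm at least 4 are far enough; at a corner, the last clause of [coreduced]
    conflicts with [w - a] lying in the square. *)
Lemma reduced_sub w w' a : coreduced w w' -> hlattice a ->
  in_square (w - a) -> nsq (w' - a) <> 1 -> reduced (w - a) (w' - a).
Proof.
move=> [h1 h2 h3] la sq n1.
(* [w] avoids the four disks with diameter [[0, c]], and these cover the square. *)
have a0 : a != 0.
  apply/eqP => a0; move: sq; rewrite a0 subr0 => sq.
  have [c cc [d0 d1]] := corner_dot_ge w.
  by have := h1 c cc; have := sq c cc; nra.
split=> // [|c cc].
  have [/eqP|ca|a4] := hlattice_cases la; first by rewrite (negbTE a0).
    rewrite lt_neqAle; apply/andP; split; first by apply/eqP => /esym.
    rewrite leNgt; apply/negP => /(h3 _ ca).
    have := sq _ (cornerN ca).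
    by rewrite dotNl dotBr dotzz (nsq_corner ca); lra.
  exact: nsq_sub_gt1.
have -> : w' - a + c = w' - (a - c) by rewrite opprB addrA addrAC.
have ld : hlattice (a - c) by apply: hlatticeB => //; exact: corner_hlattice.
have [/eqP|cd _|d4 _] := hlattice_cases ld.
(* For [a = c] the premise on [w - a] reads [nsq w <= dot c w], against the first clause of
   [coreduced]. *)
- rewrite subr_eq0 => /eqP ->.
  rewrite nsqB dotBr dotzz (nsq_corner cc); have := h1 c cc; lra.
(* With [d = a - c], the square gives [dot d w > dot d a - 1 = dot d c + 1 >= 1]. *)
- rewrite leNgt; apply/negP => /(h3 _ cd).
  have ea : a = c + (a - c) by ring.
  have := corner_dot_ge0 cc cd; rewrite -ea => /(_ a0).
  have := sq _ (cornerN cd).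
  have e2 : dot (a - c) a = dot (a - c) c + 2.
    by rewrite {2}ea dotDr dotzz (nsq_corner cd).
  rewrite dotNl dotBr e2; lra.
- exact/ltW/nsq_sub_gt1.
Qed.

(* If d = w - v were a corner, the last clause of coreduced would give d.w < 1
   and - d.v < 1, contradicting d.(w - v) = 2. *)
Lemma coreduced_sub_inj w w' v v' a b : coreduced w w' -> coreduced v v' ->
  hlattice a -> hlattice b -> w - a = v - b -> w' - a = v' - b ->
  w = v /\ w' = v'.
Proof.
move=> [_ w1 hw] [_ v1 hv] la lb e e'.
have ew : w = v + (a - b) by rewrite addrA addrAC -e subrK.
have ew' : w' = v' + (a - b) by rewrite addrA addrAC -e' subrK.
have [d0|cd|d4] := hlattice_cases (hlatticeB la lb).
- by rewrite ew ew' d0 !addr0.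
- exfalso; have := hw _ cd; rewrite ew' addrK => /(_ v1).
  have := hv _ (cornerN cd); rewrite opprK -ew' => /(_ w1).
  rewrite ew dotNl dotDr dotzz (nsq_corner cd); lra.
- by exfalso; have := nsq_sub_gt1 w1 d4; rewrite ew' addrK; lra.
Qed.

End NaturalExtension.

(** * Conjugate pairs over Q(i) *)

Section Arithmetic.
Variable R : realType.
Local Notation C := (CC R).
Implicit Types z w c a b g : C.

Lemma gauss_intP z : gauss_int z <-> re z \is a Num.int /\ im z \is a Num.int.
Proof.
split=> [[a [b ->]]|[]]; first by rewrite /= !intr_int.
by move=> /intrP[a ha] /intrP[b hb]; exists a, b; apply: complex_eq.
Qed.

Lemma gauss_intD z w : gauss_int z -> gauss_int w -> gauss_int (z + w).
Proof.
move=> /gauss_intP[? ?] /gauss_intP[? ?]; apply/gauss_intP.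
by rewrite !coordE !rpredD.
Qed.

Lemma gauss_intN z : gauss_int z -> gauss_int (- z).
Proof. by move=> /gauss_intP[? ?]; apply/gauss_intP; rewrite !coordE !rpredN. Qed.

Lemma gauss_intM z w : gauss_int z -> gauss_int w -> gauss_int (z * w).
Proof.
move=> /gauss_intP[? ?] /gauss_intP[? ?]; apply/gauss_intP.
by rewrite !coordE rpredB ?rpredD ?rpredM.
Qed.

Lemma gauss_intJ z : gauss_int z -> gauss_int (conjc z).
Proof. by move=> /gauss_intP[? ?]; apply/gauss_intP; rewrite !coordE rpredN. Qed.

Lemma gauss_int0 : gauss_int (0 : C).
Proof. by exists 0, 0; apply: complex_eq. Qed.

Lemma gauss_int1 : gauss_int (1 : C).
Proof. by exists 1, 0; apply: complex_eq. Qed.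

Lemma gauss_nsq_int z : gauss_int z -> nsq z \is a Num.int.
Proof. by move=> /gauss_intP[? ?]; rewrite rpredD ?rpredX. Qed.

Lemma gauss_nsq_ge1 z : gauss_int z -> z != 0 -> 1 <= nsq z.
Proof.
move=> /gauss_nsq_int /intrP[k hk]; rewrite -nsq_gt0 hk ltr0z => k0.
by rewrite ler1z.
Qed.

Lemma hlattice_gauss w : hlattice w -> gauss_int w.
Proof.
by move=> /hlattice_coord[p [q [h1 h2]]]; apply/gauss_intP; rewrite h1 h2 !intr_int.
Qed.

Definition is_rat (x : R) : Prop := exists q : rat, x = ratr q.

Lemma int_is_rat (x : R) : x \is a Num.int -> is_rat x.
Proof. by move=> /intrP[k ->]; exists k%:~R; rewrite ratr_int. Qed.

Lemma is_ratD x y : is_rat x -> is_rat y -> is_rat (x + y).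
Proof. by move=> [p ->] [q ->]; exists (p + q); rewrite rmorphD. Qed.

Lemma is_ratN x : is_rat x -> is_rat (- x).
Proof. by move=> [p ->]; exists (- p); rewrite rmorphN. Qed.

Lemma is_ratM x y : is_rat x -> is_rat y -> is_rat (x * y).
Proof. by move=> [p ->] [q ->]; exists (p * q); rewrite rmorphM. Qed.

Lemma is_ratV x : is_rat x -> is_rat x^-1.
Proof. by move=> [p ->]; exists (p^-1); rewrite fmorphV. Qed.

Lemma gauss_ratP z : gauss_rat z <-> is_rat (re z) /\ is_rat (im z).
Proof.
split=> [[p [q ->]]|[[p hp] [q hq]]]; first by split; [exists p|exists q].
by exists p, q; apply: complex_eq.
Qed.

Lemma gauss_int_rat z : gauss_int z -> gauss_rat z.
Proof.
by move=> /gauss_intP[? ?]; apply/gauss_ratP; split; exact: int_is_rat.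
Qed.

Lemma gauss_ratM z w : gauss_rat z -> gauss_rat w -> gauss_rat (z * w).
Proof.
move=> /gauss_ratP[? ?] /gauss_ratP[? ?]; apply/gauss_ratP; rewrite !coordE.
by split; apply: is_ratD; rewrite ?reN; try apply: is_ratN; exact: is_ratM.
Qed.

Lemma gauss_ratV z : gauss_rat z -> gauss_rat z^-1.
Proof.
move=> /gauss_ratP[h1 h2]; apply/gauss_ratP; rewrite reV imV.
have h3 : is_rat (nsq z)^-1 by apply/is_ratV/is_ratD; rewrite expr2; exact: is_ratM.
by split; apply: is_ratM => //; exact: is_ratN.
Qed.

Variable s : C.
Hypothesis s2_int : gauss_int (s ^+ 2).
Hypothesis s_irr : ~ gauss_rat s.

Lemma s_neq0 : s != 0.
Proof.
by apply/eqP => s0; apply: s_irr; rewrite s0; exact/gauss_int_rat/gauss_int0.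
Qed.

Lemma irrational_affine g b : gauss_int g -> gauss_int b -> g * s = b -> g = 0.
Proof.
move=> gg gb e; apply/eqP/negPn/negP => g0; apply: s_irr.
have -> : s = b * g^-1 by rewrite -e mulrAC mulfV ?mul1r.
by apply: gauss_ratM; [|apply: gauss_ratV]; exact: gauss_int_rat.
Qed.

(* If Re (g s) were a nonzero rational, the integrality of (g s)^2 would make
   Im (g s) rational too. *)
Lemma rational_re_eq0 g : gauss_int g -> is_rat (re (g * s)) -> re (g * s) = 0.
Proof.
move=> gg rx; apply/eqP/negPn/negP => x0.
have g0 : g != 0.
  by apply: contraNneq x0 => ->; rewrite mul0r.
have rg2 : gauss_int ((g * s) ^+ 2).
  by rewrite exprMn; apply: gauss_intM => //; rewrite expr2; exact: gauss_intM.
have rt : gauss_rat (g * s).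
  apply/gauss_ratP; split=> //.
  have -> : im (g * s) = im ((g * s) ^+ 2) * ((1 + 1) * re (g * s))^-1.
    rewrite expr2 [im (_ * (g * s))]imM; move: x0; set x := re _; set y := im _ => x0.
    by field.
  apply: is_ratM; first by move: rg2 => /gauss_intP[_] /int_is_rat.
  apply/is_ratV/is_ratM => //; apply: is_ratD; exact/int_is_rat/rpred1.
apply: s_irr; have -> : s = g^-1 * (g * s) by rewrite mulKf.
apply: gauss_ratM => //; exact/gauss_ratV/gauss_int_rat.
Qed.

(* z and z' are the two roots of A X^2 + 2 b X + (b^2 - s^2) / A. *)
Definition conjugates z z' : Prop := exists A b,
  [/\ gauss_int A, A != 0, gauss_int b, gauss_int ((b ^+ 2 - s ^+ 2) / A)
    & A * z + b = s /\ A * z' + b = - s].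

Lemma conjugates_start : conjugates s (- s).
Proof.
exists 1, 0; split; rewrite ?mul1r ?addr0 ?oner_neq0 //.
- exact: gauss_int1.
- exact: gauss_int0.
- by rewrite expr0n /= sub0r divr1; exact: gauss_intN.
Qed.

Lemma conjugates_neq0 z z' : conjugates z z' -> z != 0 /\ z' != 0.
Proof.
move=> [A [b [gA A0 gb gc [e e']]]]; split; apply/eqP => z0.
  move: e; rewrite z0 mulr0 add0r => e.
  by have /eqP := irrational_affine gauss_int1 gb (etrans (mul1r _) (esym e));
     rewrite oner_eq0.
move: e'; rewrite z0 mulr0 add0r => e'.
have /eqP := irrational_affine (gauss_intN gauss_int1) gb (etrans (mulN1r _) (esym e')).
by rewrite oppr_eq0 oner_eq0.
Qed.

(** Reversing the quadratic gives the coefficients [- C], [- b], [- A], where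
    [C = (b^2 - s^2) / A = A z z']; the overall sign keeps [s] attached to the first root. *)
Lemma conjugatesV z z' : conjugates z z' -> conjugates z^-1 z'^-1.
Proof.
move=> cz; have [z0 z'0] := conjugates_neq0 cz.
case: cz => A [b [gA A0 gb gc [e e']]].
have C0 : (b ^+ 2 - s ^+ 2) / A != 0.
  have -> : b ^+ 2 - s ^+ 2 = (A * z) * (A * z').
    have -> : A * z = s - b by rewrite -e addrK.
    have -> : A * z' = - s - b by rewrite -e' addrK.
    ring.
  by rewrite !mulf_neq0 ?invr_eq0.
exists (- ((b ^+ 2 - s ^+ 2) / A)), (- b); split.
- exact: gauss_intN.
- by rewrite oppr_eq0.
- exact: gauss_intN.
- have -> : ((- b) ^+ 2 - s ^+ 2) / - ((b ^+ 2 - s ^+ 2) / A) = - A.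
    have nz : b ^+ 2 - s ^+ 2 != 0 by apply: contraNneq C0 => ->; rewrite mul0r.
    by field; rewrite A0 nz.
  exact: gauss_intN.
- have e1 : A * z = s - b by rewrite -e addrK.
  have e2 : A * z' = - s - b by rewrite -e' addrK.
  have -> : (b ^+ 2 - s ^+ 2) / A = A * z * z'.
    apply: (mulfI A0); rewrite mulrCA mulfV // mulr1.
    have -> : A * (A * z * z') = (A * z) * (A * z') by ring.
    by rewrite e1 e2; ring.
  split.
    have -> : - (A * z * z') * z^-1 = - (A * z') by field.
    by rewrite e2; ring.
  have -> : - (A * z * z') * z'^-1 = - (A * z) by field.
  by rewrite e1; ring.
Qed.

Lemma conjugates_sub z z' a : gauss_int a -> conjugates z z' ->
  conjugates (z - a) (z' - a).
Proof.
move=> ga [A [b [gA A0 gb gc [e e']]]].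
exists A, (b + A * a); split=> //.
- by apply: gauss_intD => //; exact: gauss_intM.
- have -> : ((b + A * a) ^+ 2 - s ^+ 2) / A =
     (b ^+ 2 - s ^+ 2) / A + (b * a + b * a + A * (a * a)) by field.
  apply: gauss_intD => //.
  by apply: gauss_intD; [apply: gauss_intD|];
     do ?[exact: gauss_intM | apply: gauss_intM => //].
- by rewrite -{1}e -{1}e'; split; ring.
Qed.

(** The equation of the line makes [re (h * s)] rational, hence 0 by [rational_re_eq0]; so replacing
    [s] by [- s] leaves the equation unchanged. *)
Lemma conjugates_line z z' g : conjugates z z' -> gauss_int g ->
  is_rat (dot g z) -> dot g z' = dot g z.
Proof.
move=> [A [b [gA A0 gb gc [e e']]]] gg rz.
have e1 : A * z = s - b by rewrite -e addrK.
have e2 : A * z' = - s - b by rewrite -e' addrK.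
set h := conjc (g * A).
have key u : re (h * (A * u)) = nsq A * dot g u.
  by rewrite /h /nsq /dot !coordE; ring.
have gh : gauss_int h by exact/gauss_intJ/gauss_intM.
have hs0 : re (h * s) = 0.
  apply: rational_re_eq0 => //.
  have -> : re (h * s) = nsq A * dot g z + re (h * b).
    by rewrite -key e1 !coordE; ring.
  apply: is_ratD; last first.
    by have /gauss_intP[/int_is_rat] := gauss_intM gh gb.
  by apply: is_ratM => //; apply: int_is_rat; exact: gauss_nsq_int.
have nA : nsq A != 0 by rewrite nsq_eq0.
apply: (mulfI nA); rewrite -!key e1 e2.
have d u v : re (h * (u - v)) = re (h * u) - re (h * v) by rewrite !coordE; ring.
have -> : - s - b = 0 - s - b by rewrite sub0r.
by rewrite !d hs0 mulr0 subr0.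
Qed.

(* Expanding |s + b|^2 = |A|^2 forces |s|^2 to be rational, hence
   Re (b^* s) = 0, and the equation is invariant under s -> - s. *)
Lemma conjugates_circle z z' : conjugates z z' -> nsq z' = 1 -> nsq z = 1.
Proof.
move=> [A [b [gA A0 gb gc [e e']]]] n1.
have e1 : A * z = s - b by rewrite -e addrK.
have e2 : A * z' = - (s - - b) by rewrite opprB addrC -e' addrK.
have h1 : nsq A = nsq s + 2 * dot b s + nsq b.
  have := nsqM A z'; rewrite e2 n1 mulr1 nsqN nsqB dotNl nsqN => <-; ring.
have h2 : nsq A * nsq z = nsq s - 2 * dot b s + nsq b by rewrite -nsqM e1 nsqB.
have nA : nsq A != 0 by rewrite nsq_eq0.
have rA := int_is_rat (gauss_nsq_int gA).
have rb := int_is_rat (gauss_nsq_int gb).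
have rN := int_is_rat (gauss_nsq_int s2_int).
have [rp _] : is_rat (re (conjc b ^+ 2 * s ^+ 2)) /\
  is_rat (im (conjc b ^+ 2 * s ^+ 2)).
  apply/gauss_ratP/gauss_int_rat/gauss_intM => //; rewrite expr2.
  by apply: gauss_intM; exact: gauss_intJ.
have i2 : is_rat 2 by apply: int_is_rat; exact: (intr_int R 2).
have rr : is_rat (nsq s).
  (* Square [nsq A - nsq b - nsq s = 2 dot b s], which is [h1]. As [(nsq s)^2 = nsq (s^2)] is
     rational, the result is linear in [nsq s]. *)
  have -> : nsq s = ((nsq A - nsq b) * (nsq A - nsq b) + nsq (s ^+ 2)
     - 2 * re (conjc b ^+ 2 * s ^+ 2)) * (2 * nsq A)^-1.
    have n4 : 2 * nsq A != 0 by rewrite mulf_neq0 // pnatr_eq0.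
    apply: (mulIf n4); rewrite mulfVK //.
    have -> : nsq (s ^+ 2) = nsq s * nsq s by rewrite expr2 nsqM.
    have -> : re (conjc b ^+ 2 * s ^+ 2) = 2 * dot b s ^+ 2 - nsq b * nsq s.
      by rewrite !expr2 /dot /nsq !coordE; ring.
    by rewrite h1; ring.
  apply: is_ratM.
    do !(assumption || apply: is_ratD || apply: is_ratN || apply: is_ratM) => //.
  by apply: is_ratV; exact: is_ratM.
have d0 : dot b s = 0.
  rewrite dotE; apply: rational_re_eq0; first exact: gauss_intJ.
  rewrite -dotE; have -> : dot b s = (nsq A - nsq b - nsq s) / 2 by rewrite h1; field.
  apply: is_ratM; last exact: is_ratV.
  by do !(assumption || apply: is_ratD || apply: is_ratN).
apply: (mulfI nA); rewrite h2 h1 d0; ring.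
Qed.

(** The lines [dot c w = 2 k + 1] carry the edges of all cells, because [dot c] takes even values on
    [hlattice]. *)
Definition off_grid w : Prop :=
  forall c (k : int), corner c -> dot c w <> (2 * k + 1)%:~R.

Lemma corner_gauss c : corner c -> gauss_int c.
Proof. by move=> cc; exact/hlattice_gauss/corner_hlattice. Qed.

(** A rational line through [s] also passes through [- s], so an odd integer would equal its
    opposite. *)
Lemma off_grid_start : off_grid s.
Proof.
move=> c k cc e.
have := conjugates_line conjugates_start (corner_gauss cc).
rewrite e => /(_ (int_is_rat (intr_int _ _))).
have -> : dot c (- s) = - dot c s by rewrite /dot !coordE; ring.
by rewrite e -rmorphN => /intr_inj; lia.
Qed.

(* A rational line c.w = k also contains w', which lies in the unit disk; so
   k = 1 or -1, and w' then lies in the disk about the corner k c as well. *)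
Lemma off_grid_coreduced w w' : conjugates w w' -> coreduced w w' -> off_grid w.
Proof.
move=> cw [_ w1 h] c k cc e.
have e' := conjugates_line cw (corner_gauss cc).
rewrite e in e'; move/(_ (int_is_rat (intr_int _ _))) in e'.
have one d : corner d -> dot d w = 1 -> dot d w' = 1 -> False.
  move=> cd d1 d2; have := h d cd; rewrite nsqB d1 d2 (nsq_corner cd).
  by move=> /(_ ltac:(lra)); rewrite ltxx.
have := dot_sqr_le c w'; rewrite e' (nsq_corner cc) => h2.
have : ((2 * k + 1) ^+ 2 < 2)%R.
  rewrite -(ltr_int R) rmorphXn /=.
  have -> : (2%:~R : R) = 2 by []. lra.
move=> h3; have : 2 * k + 1 = 1 \/ 2 * k + 1 = -1 by nia.
case=> hk; rewrite hk in e e'; first exact: (one c).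
by apply: (one (- c)); rewrite ?dotNl ?e ?e' ?opprK //; exact: cornerN.
Qed.

End Arithmetic.

(** * The floor function off the grid *)

Section Floor.
Variable R : realType.
Local Notation C := (CC R).
Implicit Types z w c a b g : C.

Lemma corner_dot_lt c z (e : R) : corner c -> 0 < e ->
  `|z| < e%:C -> `|dot c z| < e + e.
Proof.
move=> cc e0 ze.
have bre : `|re z| < e.
  by have := le_lt_trans (normc_ge_Re z) ze; rewrite ltcR.
have bim : `|im z| < e.
  have : `|z * 'i| < e%:C.
    by rewrite normrM [`|'i|]normc_def /= expr0n expr1n add0r sqrtr1 mulr1.
  move=> /(le_lt_trans (normc_ge_Re (z * 'i))); rewrite ltcR.
  by case: (z) => x y /=; rewrite mulr0 mulr1 sub0r normrN.
rewrite /dot; move: bre bim; rewrite !ltr_norml => /andP[? ?] /andP[? ?].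
by case: cc => /sqr_eq1_cases[->|->] /sqr_eq1_cases[->|->];
   apply/andP; split; lra.
Qed.

Lemma half2 : @Defs.half R * 2 = 1.
Proof. by rewrite mulVf ?pnatr_eq0. Qed.

Lemma XsqP z : Xsq z <-> exists u v : R,
  [/\ - @Defs.half R <= u < @Defs.half R, - @Defs.half R <= v < @Defs.half R
    & re z = u + v /\ im z = u - v].
Proof.
split=> [[u [v [hu hv ->]]]|[u [v [hu hv [h1 h2]]]]]; exists u, v; split=> //.
  by rewrite !coordE /=; split; ring.
by apply: complex_eq; rewrite ?h1 ?h2 !coordE /=; ring.
Qed.

Lemma in_square_Xsq z : in_square z -> Xsq z.
Proof.
move=> h; apply/XsqP; exists ((re z + im z) / 2), ((re z - im z) / 2).
have k e1 e2 : e1 ^+ 2 = 1 -> e2 ^+ 2 = 1 -> e1 * re z + e2 * im z < 1.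
  by move=> h1 h2; apply: (h (e1 +i* e2)).
have n1 : (-1 : R) ^+ 2 = 1 by rewrite sqrrN expr1n.
have p1 : (1 : R) ^+ 2 = 1 by rewrite expr1n.
have := k _ _ p1 p1; have := k _ _ p1 n1; have := k _ _ n1 p1; have := k _ _ n1 n1.
rewrite /Defs.half => *; split; first by apply/andP; split; lra.
  by apply/andP; split; lra.
by split; field.
Qed.

Lemma in_square_interior z : in_square z -> interior (@Xsq R) z.
Proof.
move=> h.
have [d d0 hd] : exists2 d : R, 0 < d & forall c, corner c -> dot c z < 1 - (d + d).
  pose m (e1 e2 : R) := 1 - dot (e1 +i* e2 : C) z.
  pose d := Num.min (Num.min (m 1 1) (m 1 (-1))) (Num.min (m (-1) 1) (m (-1) (-1))).
  have cc (e1 e2 : R) : e1 ^+ 2 = 1 -> e2 ^+ 2 = 1 -> 0 < m e1 e2.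
    by move=> h1 h2; rewrite subr_gt0; apply: h.
  have n1 : (-1 : R) ^+ 2 = 1 by rewrite sqrrN expr1n.
  have p1 : (1 : R) ^+ 2 = 1 by rewrite expr1n.
  have d0 : 0 < d by rewrite !lt_min !cc.
  (* Displacements of modulus below [d / 3] change each [dot c z] by less than [2 d / 3], strictly
     within the margin [d]. *)
  exists (d / 3); first by lra.
  move=> [e1 e2] [/= h1 h2].
  have : d <= m e1 e2.
    by case: (sqr_eq1_cases h1) => ->; case: (sqr_eq1_cases h2) => ->;
       rewrite !ge_min lexx ?orbT.
  rewrite /m; lra.
apply/nbhs_ballP; exists (d%:C); first by rewrite /= ltcR.
move=> w; rewrite -ball_normE /= => zw; apply: in_square_Xsq => c cc.
have := corner_dot_lt cc d0 zw; rewrite ltr_norml dotBr => /andP[_ ?].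
have := corner_dot_lt cc d0 zw; rewrite ltr_norml dotBr => /andP[? _].
have := hd c cc; lra.
Qed.

Lemma Xsq_dot_le z c : Xsq z -> corner c -> dot c z <= 1.
Proof.
move=> /XsqP[u [v [/andP[? ?] /andP[? ?] [h1 h2]]]] []; have := half2.
by rewrite /dot h1 h2 => ? /sqr_eq1_cases[->|->] /sqr_eq1_cases[->|->]; lra.
Qed.

Lemma closure_Xsq_dot_le z c : closure (@Xsq R) z -> corner c -> dot c z <= 1.
Proof.
move=> clz cc; rewrite leNgt; apply/negP => h.
pose d := (dot c z - 1) / 2.
have d0 : 0 < d by rewrite /d; lra.
have [|w [xw]] := clz (ball z (d%:C)); first by apply: nbhsx_ballx; rewrite ltcR.
rewrite -ball_normE /= => /(corner_dot_lt cc d0); rewrite ltr_norml dotBr => /andP[_].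
by have := Xsq_dot_le xw cc; rewrite /d; lra.
Qed.

(** Multiplication by i is an isometry permuting the corners, so the four orientations of a cell
    reduce to one. *)
Lemma iC_pow_corner k c : corner c -> exists2 d : C, corner d &
  forall z, dot c (@iC R ^+ k * z) = dot d z.
Proof.
elim: k c => [|k IH] c cc.
  by exists c => // z; rewrite expr0 mul1r.
have [d cd hd] := IH c cc.
exists (d * conjc (@iC R)).
  by case: cd => h1 h2; split; rewrite !coordE /=;
     [rewrite -[RHS]h2|rewrite -[RHS]h1]; ring.
move=> z; rewrite exprSr -mulrA hd /dot !coordE /=; ring.
Qed.

Lemma pt_dot_le k (u v : R) c :
  - @Defs.half R <= u <= @Defs.half R ->
  - @Defs.half R <= v <= @Defs.half R -> corner c ->
  dot c (pt k u v) <= 1.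
Proof.
move=> /andP[? ?] /andP[? ?] cc.
have -> : pt k u v = @iC R ^+ k * (u%:C * @onePi R + v%:C * @oneMi R).
  by rewrite /pt; ring.
have [d [h1 h2] ->] := iC_pow_corner k cc.
have := half2; rewrite /dot !coordE /= => ?.
by case: (sqr_eq1_cases h1) => ->; case: (sqr_eq1_cases h2) => ->; lra.
Qed.

Lemma Qcell_dot_le w z c : Qcell w z -> corner c -> dot c (z - w) <= 1.
Proof.
have half_le : - @Defs.half R <= @Defs.half R by have := half2; lra.
have shiftX u : Defs.shift (interior (@Xsq R)) w u -> corner c -> dot c (u - w) <= 1.
  move=> [v /interior_subset xv <-] cc; rewrite addrK; exact: Xsq_dot_le.
case=> [[-> clz]|[k [_ _ h]]|[k [_ _ h]]] cc.
- by rewrite subr0; exact: closure_Xsq_dot_le.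
- case: h => [[[/shiftX|[u /= /andP[u1 u2] <-]]|[u /= u1 <-]]|[u /= /andP[u1 u2] <-]];
  first exact; rewrite addrK; apply: pt_dot_le => //;
  by rewrite ?lexx ?u2 ?(ltW u1) ?half_le.
- case: h => [[/shiftX|[u /= /andP[u1 u2] <-]]|[u /= /andP[u1 u2] <-]];
  first exact; rewrite addrK; apply: pt_dot_le => //;
  by rewrite ?lexx ?u2 ?(ltW u1) ?half_le.
Qed.

Lemma re_int (m : int) : re (m%:~R : C) = m%:~R.
Proof. by rewrite -[m%:~R : C](rmorph_int (real_complex R)). Qed.

Lemma im_int (m : int) : im (m%:~R : C) = 0.
Proof. by rewrite -[m%:~R : C](rmorph_int (real_complex R)). Qed.

(** [m] and [l] are coordinates in the basis [1 + i], [1 - i]. If exactly one vanishes the point is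
    on a ray, if none does it is in a sector, and the signs select [k]. *)
Lemma lattice_ray_or_sector (m l : int) :
  let w : C := (m + l)%:~R +i* (m - l)%:~R in
  [\/ w = 0, exists2 k, (k < 4)%N & Lray k w | exists2 k, (k < 4)%N & Lsector k w].
Proof.
move=> w.
(* [a] and [b] encode [i^k = a + b i], so that one computation serves all four rotations. *)
have rayE k (n a b : int) : 0 < n ->
    (forall z, @iC R ^+ k * z = (a%:~R * re z - b%:~R * im z)
        +i* (b%:~R * re z + a%:~R * im z)) ->
    m + l = n * (a - b) -> m - l = n * (a + b) -> Lray k w.
  move=> n0 ik e1 e2; exists n => //; apply: complex_eq;
  rewrite /w e1 e2 -mulrA ik !coordE re_int im_int /=; ring.
have secE k (n p a b : int) : 0 < n -> 0 < p ->
    (forall z, @iC R ^+ k * z = (a%:~R * re z - b%:~R * im z)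
        +i* (b%:~R * re z + a%:~R * im z)) ->
    m + l = (n + p) * a - (n - p) * b ->
    m - l = (n - p) * a + (n + p) * b -> Lsector k w.
  move=> n0 p0 ik e1 e2; exists n, p; split => //; apply: complex_eq;
  rewrite /w e1 e2 ik !coordE !re_int !im_int /=; ring.
have ik0 z : @iC R ^+ 0 * z = (1%:~R * re z - 0%:~R * im z)
        +i* (0%:~R * re z + 1%:~R * im z).
  by rewrite expr0; apply: complex_eq; rewrite !coordE /=; ring.
have ik1 z : @iC R ^+ 1 * z = (0%:~R * re z - 1%:~R * im z)
        +i* (1%:~R * re z + 0%:~R * im z).
  by rewrite expr1; apply: complex_eq; rewrite !coordE /=; ring.
have ik2 z : @iC R ^+ 2 * z = ((-1)%:~R * re z - 0%:~R * im z)
        +i* (0%:~R * re z + (-1)%:~R * im z).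
  by rewrite expr2; apply: complex_eq; rewrite !coordE /=; ring.
have ik3 z : @iC R ^+ 3 * z = (0%:~R * re z - (-1)%:~R * im z)
        +i* ((-1)%:~R * re z + 0%:~R * im z).
  by rewrite exprS expr2; apply: complex_eq; rewrite !coordE /=; ring.
have [m0|m0|m0] := ltgtP m 0; have [l0|l0|l0] := ltgtP l 0.
- constructor 3; exists 2%N => //; apply: (secE _ (- m) (- l) _ _ _ _ ik2); lia.
- constructor 3; exists 3%N => //; apply: (secE _ l (- m) _ _ _ _ ik3); lia.
- constructor 2; exists 2%N => //; apply: (rayE _ (- m) _ _ _ ik2); lia.
- constructor 3; exists 1%N => //; apply: (secE _ (- l) m _ _ _ _ ik1); lia.
- constructor 3; exists 0%N => //; apply: (secE _ m l _ _ _ _ ik0); lia.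
- constructor 2; exists 0%N => //; apply: (rayE _ m _ _ _ ik0); lia.
- constructor 2; exists 1%N => //; apply: (rayE _ (- l) _ _ _ ik1); lia.
- constructor 2; exists 3%N => //; apply: (rayE _ l _ _ _ ik3); lia.
- by constructor 1; rewrite /w m0 l0.
Qed.

Lemma Qcell_interior w z : hlattice w -> in_square (z - w) -> Qcell w z.
Proof.
move=> /hlattice_coord[p [q [e1 e2]]] sq.
have sh : Defs.shift (interior (@Xsq R)) w z.
  by exists (z - w); [exact: in_square_interior|rewrite subrK].
have ew : w = (p + - q)%:~R +i* (p - - q)%:~R.
  by apply: complex_eq; rewrite ?e1 ?e2 ?opprK.
have := lattice_ray_or_sector p (- q); rewrite /= -ew => -[w0|[k k4 h]|[k k4 h]].
- constructor 1; split=> //; apply: subset_closure; apply: in_square_Xsq.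
  by rewrite w0 subr0 in sq.
- by constructor 2; exists k; split=> //; left; left; left.
- by constructor 3; exists k; split=> //; left; left.
Qed.

Lemma off_grid_dot_lt1 w z c : off_grid z -> hlattice w -> corner c ->
  dot c (z - w) <= 1 -> dot c (z - w) < 1.
Proof.
move=> og lw cc; rewrite le_eqVlt => /orP[/eqP e|//]; exfalso.
have [k hk] : exists k : int, dot c w = (2 * k)%:~R.
  move/hlattice_coord: lw => [p [q [e1 e2]]]; rewrite /dot e1 e2.
  case: cc => /sqr_eq1_cases[->|->] /sqr_eq1_cases[->|->].
  - by exists p; ring.
  - by exists (- q); ring.
  - by exists q; ring.
  - by exists (- p); ring.
apply: (og c k cc); move: e; rewrite dotBr hk rmorphD rmorph1; lra.
Qed.

Lemma hfloor_off_grid z : off_grid z ->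
  hlattice (hfloor z) /\ in_square (z - hfloor z).
Proof.
move=> og; rewrite /hfloor; case: asboolP => gz.
  split; last by move=> c cc; rewrite subrr /dot /= !mulr0 addr0.
  case: gz => a [b ez].
  (* A Gaussian integer is its own floor. It is in [hlattice] when its coordinates have equal
     parity; otherwise it lies on an odd line for the corner [1 + i]. *)
  have : (exists p q : int, a = p - q /\ b = p + q) \/ exists k, a + b = 2 * k + 1.
    have [[k hk]|] : (exists k, a + b = 2 * k) \/ (exists k, a + b = 2 * k + 1).
    + have := divz_eq (a + b) 2; have := modz_ge0 (a + b) (isT : (2 : int) != 0).
      have := ltz_mod (a + b) (isT : (2 : int) != 0) => h1 h2 h3.
      have : (((a + b) %% 2)%Z = 0 \/ ((a + b) %% 2)%Z = 1) by lia.
      by case=> h4; [left|right]; exists ((a + b) %/ 2)%Z; lia.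
    + by left; exists k, (b - k); lia.
    + by right.
  case=> [[p [q [ha hb]]]|[k hk]]; first by apply: (@hlatticeP _ _ p q); rewrite ez ?ha ?hb.
  exfalso; apply: (og (1 +i* 1) k); first by split; rewrite /= expr1n.
  by rewrite -hk ez /dot /= !mul1r -rmorphD.
case: xgetP => [w -> [lw Qw]|noQ].
  by split=> // c cc; apply: off_grid_dot_lt1 => //; exact: Qcell_dot_le.
(* The default of [xget] is never reached: rounding the coordinates of [z] in the basis [1 + i],
   [1 - i] yields a cell containing [z]. *)
pose m := Num.floor ((re z + im z + 1) / 2).
pose l := Num.floor ((re z - im z + 1) / 2).
pose w : C := (m + l)%:~R +i* (m - l)%:~R.
have lw : hlattice w by apply: (@hlatticeP _ _ m (- l)); rewrite /w ?opprK.
exfalso; apply: (noQ w); split=> //; apply: Qcell_interior => // c cc.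
apply: off_grid_dot_lt1 => //.
have := floor_itv ((re z + im z + 1) / 2); rewrite -/m => /andP[].
have := floor_itv ((re z - im z + 1) / 2); rewrite -/l => /andP[].
rewrite /dot !coordE /= !rmorphD !rmorphN /=.
by case: cc => /sqr_eq1_cases[->|->] /sqr_eq1_cases[->|->]; lra.
Qed.

End Floor.

(** * Finiteness *)

Section Finiteness.
Variable R : realType.
Local Notation C := (CC R).
Implicit Types z w c a b g u : C.

Lemma finite_gauss_int (M : R) :
  finite_set [set a : C | gauss_int a /\ nsq a <= M]%classic.
Proof.
pose N := Num.bound M.
pose g (i : nat * nat) : C :=
  (i.1%:Z - N%:Z)%:~R +i* (i.2%:Z - N%:Z)%:~R.
apply: (@sub_finite_set _ _ (g @` (`I_(N + N) `*` `I_(N + N)))%classic); last first.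
  by apply: finite_image; apply: finite_setX; exact: finite_II.
have bound (k : int) : (k%:~R : R) ^+ 2 <= M -> `|k| < N%:Z.
  move=> kM; have M0 : 0 <= M by apply: le_trans kM; exact: sqr_ge0.
  have : (k ^+ 2 < N%:Z)%R.
    rewrite -(ltr_int R) rmorphXn /=; apply: le_lt_trans kM _.
    exact: archi_boundP.
  nia.
move=> a [[p [q ea]]]; rewrite /nsq ea /= => le.
have /bound hp : (p%:~R : R) ^+ 2 <= M by have := sqr_ge0 (q%:~R : R); lra.
have /bound hq : (q%:~R : R) ^+ 2 <= M by have := sqr_ge0 (p%:~R : R); lra.
exists (absz (p + N%:Z), absz (q + N%:Z)); first by split => /=; lia.
by rewrite /g /=; congr (_%:~R +i* _%:~R); lia.
Qed.

Variable s : C.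
Hypothesis s2_int : gauss_int (s ^+ 2).
Hypothesis s_irr : ~ gauss_rat s.

(* With e = 1 - z/u and e' = 1 - z'/u, A e e' is, up to a unit, the value at u
   of A X^2 + 2 b X + (b^2 - s^2) / A, hence a nonzero Gaussian integer; so
   1/e - 1/e' is bounded, while Re (1/e') < 1/2 because |z'| > 1. *)
Lemma unit_gap A b z z' u (S : R) :
  gauss_int A -> A != 0 -> gauss_int b -> gauss_int ((b ^+ 2 - s ^+ 2) / A) ->
  A * z + b = s -> A * z' + b = - s ->
  1 < nsq z' -> gauss_int u -> nsq u = 1 -> 0 <= S -> nsq s <= S ^+ 2 ->
  im (conjc u * z) ^+ 2 <= (1 - dot u z) ^+ 2 -> dot u z < 1 ->
  1 <= (1 + 4 * S) * (1 - dot u z).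
Proof.
move=> gA A0 gb gc ez ez' z'1 gu u1 S0 sS him hre.
set r := 1 - dot u z in him *.
pose e := 1 - conjc u * z; pose e' := 1 - conjc u * z'.
have ree : re e = r by rewrite /e /r dotE !coordE.
have ime : im e = - im (conjc u * z) by rewrite /e imD imN /= add0r.
have r0 : 0 < r by rewrite subr_gt0.
have e0 : e != 0 by apply/eqP => e0; move: r0; rewrite -ree e0 /= ltxx.
have uu : conjc u * u = 1.
  by apply: complex_eq; rewrite !coordE /=; [rewrite -u1 /nsq|]; ring.
have nz' : 1 < nsq (1 - e').
  by rewrite /e' opprB addrC subrK nsqM nsqJ u1 mul1r.
have e'0 : e' != 0.
  apply/eqP => e'0; move: nz'; rewrite e'0 subr0.
  by rewrite /nsq /= expr1n expr0n addr0 ltxx.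
have e1 : A * z = s - b by rewrite -ez addrK.
have e2 : A * z' = - s - b by rewrite -ez' addrK.
have K : A * e * e' = conjc u ^+ 2 *
    (A * (u * u) + (b * u + b * u) + (b ^+ 2 - s ^+ 2) / A).
  have -> : (b ^+ 2 - s ^+ 2) / A = A * z * z'.
    apply: (mulfI A0); rewrite mulrCA mulfV // mulr1.
    have -> : A * (A * z * z') = (A * z) * (A * z') by ring.
    by rewrite e1 e2; ring.
  have -> : e = conjc u * (u - z) by rewrite mulrBr uu.
  have -> : e' = conjc u * (u - z') by rewrite mulrBr uu.
  have -> : b * u + b * u = - (A * z + A * z') * u by rewrite e1 e2; ring.
  ring.
have nK : 1 <= nsq (A * e * e').
  apply: gauss_nsq_ge1; last by rewrite !mulf_neq0.
  rewrite K expr2; apply: gauss_intM; first by apply: gauss_intM; exact: gauss_intJ.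
  apply: gauss_intD => //.
  by apply: gauss_intD; [|apply: gauss_intD];
     do ?[exact: gauss_intM | apply: gauss_intM => //].
have nd : nsq A * nsq (e' - e) = 4 * nsq s.
  have : nsq (A * (e' - e)) = nsq (conjc u * (s + s)).
    congr nsq.
    have -> : A * (e' - e) = conjc u * (A * z - A * z') by rewrite /e /e'; ring.
    by rewrite e1 e2; ring.
  rewrite !nsqM nsqJ u1 mul1r => ->; rewrite /nsq !coordE; ring.
have E0 : 0 < nsq e by rewrite nsq_gt0.
have E'0 : 0 < nsq e' by rewrite nsq_gt0.
have nA0 : 0 < nsq A by rewrite nsq_gt0.
(* The difference is the quotient of [A (e' - e)], of modulus [2 |s|], by [A e e'], of modulus at
   least 1. *)
have dinv : nsq (e^-1 - e'^-1) <= (2 * S) ^+ 2.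
  have -> : e^-1 - e'^-1 = (e' - e) * (e * e')^-1 by field; rewrite e0 e'0.
  rewrite nsqM nsqV nsqM ler_pdivrMr ?mulr_gt0 //.
  rewrite -(ler_pM2l nA0) nd.
  have -> : nsq A * ((2 * S) ^+ 2 * (nsq e * nsq e')) =
    4 * (S ^+ 2 * nsq (A * e * e')) by rewrite !nsqM; ring.
  rewrite ler_pM2l //; apply: le_trans sS _.
  by rewrite ler_peMr // sqr_ge0.
have rdiff : re e^-1 - re e'^-1 <= 2 * S.
  have -> : re e^-1 - re e'^-1 = re (e^-1 - e'^-1) by rewrite !coordE.
  have S2 : 0 <= 2 * S by lra.
  have sq : re (e^-1 - e'^-1) ^+ 2 <= (2 * S) ^+ 2.
    by apply: le_trans dinv; rewrite lerDl sqr_ge0.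
  rewrite leNgt; apply/negP => lt.
  by have : (2 * S) ^+ 2 < re (e^-1 - e'^-1) ^+ 2; [rewrite ltrXn2r|lra].
(* [nsq (1 - e') > 1] says that [2 re e' < nsq e']. *)
have re' : re e'^-1 < 2^-1.
  rewrite reV ltr_pdivrMr //.
  have : nsq (1 - e') = 1 - 2 * re e' + nsq e' by rewrite /nsq !coordE /=; ring.
  lra.
(* By [him], [|im e| <= r = re e], hence [nsq e <= 2 r^2]. *)
have rer : (2 * r)^-1 <= re e^-1.
  rewrite reV ree ler_pdivlMr // mulrC ler_pdivrMr ?mulr_gt0 //.
  rewrite {1}/nsq ree ime sqrrN; lra.
have r2 : 0 < 2 * r by rewrite mulr_gt0.
have : 2 * r * (2 * r)^-1 <= 2 * r * (2 * S + 2^-1) by rewrite ler_pM2l //; lra.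
rewrite mulfV ?gt_eqF //; lra.
Qed.

(** Applied at the four units, [unit_gap] keeps [z] away from the vertices, hence from the unit
    circle. Then [|z'| > 1] separates [z'] from [z], and [A (z' - z) = - 2 s] bounds [A]. *)
Lemma leading_coef_bound A b z z' (S : R) :
  gauss_int A -> A != 0 -> gauss_int b -> gauss_int ((b ^+ 2 - s ^+ 2) / A) ->
  A * z + b = s -> A * z' + b = - s -> reduced z z' ->
  0 <= S -> nsq s <= S ^+ 2 ->
  nsq A <= 64 * S ^+ 2 * (1 + 4 * S) ^+ 2.
Proof.
move=> gA A0 gb gc ez ez' [sq z'1 _] S0 sS.
have n1 : (-1 : R) ^+ 2 = 1 by rewrite sqrrN expr1n.
have p1 : (1 : R) ^+ 2 = 1 by rewrite expr1n.
have k e1 e2 : e1 ^+ 2 = 1 -> e2 ^+ 2 = 1 -> e1 * re z + e2 * im z < 1.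
  by move=> h1 h2; apply: (sq (e1 +i* e2)).
have k1 := k _ _ p1 p1; have k2 := k _ _ p1 n1.
have k3 := k _ _ n1 p1; have k4 := k _ _ n1 n1.
have gap (p q : int) : p ^+ 2 + q ^+ 2 = 1 ->
    1 <= (1 + 4 * S) * (1 - (p%:~R * re z + q%:~R * im z)).
  move=> pq; have gu : gauss_int (p%:~R +i* q%:~R : C) by exists p, q.
  have hu : [\/ p = 1 /\ q = 0, p = -1 /\ q = 0, p = 0 /\ q = 1
           | p = 0 /\ q = -1].
    have : `|p| <= 1 by nia.
    have : `|q| <= 1 by nia.
    move=> hq hp; have : p = 0 \/ p = 1 \/ p = -1 by lia.
    case=> [p0|[p0|p0]]; rewrite p0 in pq *.
    + have : q = 1 \/ q = -1 by nia.
      by case=> ->; [constructor 3|constructor 4].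
    + by constructor 1; split=> //; nia.
    + by constructor 2; split=> //; nia.
  apply: (unit_gap gA A0 gb gc ez ez' z'1 gu) => //.
  - by rewrite /nsq /= -!rmorphXn -rmorphD /= pq.
  (* The square has right angles at its vertices, which is the cone condition of [unit_gap]. *)
  - rewrite /dot !coordE /=.
    by case: hu => -[-> ->]; rewrite ?mulrN1z /=; nra.
  - by rewrite /dot /=; case: hu => -[-> ->]; rewrite ?mulrN1z /=; lra.
set T := 1 + 4 * S in gap *.
have T1 : 1 <= T by rewrite /T; lra.
have g1 := gap 1 0 (erefl _); have g2 := gap (-1) 0 (erefl _).
have g3 := gap 0 1 (erefl _); have g4 := gap 0 (-1) (erefl _).
rewrite ?rmorphN ?rmorph1 ?rmorph0 /= in g1 g2 g3 g4.
pose d := T^-1.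
have T0 : 0 < T by lra.
have d0 : 0 < d by rewrite invr_gt0.
have Td : T * d = 1 by rewrite mulfV ?gt_eqF.
have d1 : d <= 1 by rewrite invf_le1.
have gd t : 1 <= T * t -> d <= t by rewrite -Td ler_pM2l.
move: g1 g2 g3 g4 => /gd g1 /gd g2 /gd g3 /gd g4.
have zd : nsq z <= 1 - d.
  (* Here [p^2 + q^2 <= max(p, q) (p + q) <= max(p, q)]. *)
  have aux p q : 0 <= p -> 0 <= q -> p + q < 1 -> p <= 1 - d -> q <= 1 - d ->
      p ^+ 2 + q ^+ 2 <= 1 - d.
    move=> p0 q0 pq hp hq; rewrite !expr2.
    have [le|/ltW le] := leP p q.
      have := ler_wpM2r p0 le; have := ler_wpM2l q0 (ltW pq); lra.
    have := ler_wpM2r q0 le; have := ler_wpM2l p0 (ltW pq); lra.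
  rewrite /nsq -(real_normK (num_real (re z))) -(real_normK (num_real (im z))).
  apply: aux => //; first by case: (ger0P (re z)) => _; case: (ger0P (im z)) => _; lra.
    by rewrite ler_norml; apply/andP; split; lra.
  by rewrite ler_norml; apply/andP; split; lra.
(* Otherwise Cauchy-Schwarz gives [4 dot z (z' - z) < d], and
   [nsq z' < 1 - d + d / 2 + d^2 / 16 < 1]. *)
have hd : d ^+ 2 <= 16 * nsq (z' - z).
  have := dot_sqr_le z (z' - z).
  have : nsq z' = nsq z + 2 * dot z (z' - z) + nsq (z' - z).
    by rewrite nsqB dotBr dotzz; ring.
  have := nsq_ge0 (z' - z); have := nsq_ge0 z.
  move: (nsq (z' - z)) (dot z (z' - z)) => H D z0 H0 e cs.
  rewrite leNgt; apply/negP => lt.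
  have D2 : (4 * D) ^+ 2 < d ^+ 2.
    rewrite exprMn; have : nsq z * H <= 1 * H by apply: ler_wpM2r => //; lra.
    have -> : (4 : R) ^+ 2 = 16 by rewrite expr2; ring. lra.
  have D3 : 4 * D < d.
    rewrite ltNge; apply/negP => le.
    by have := ler_pM (ltW d0) (ltW d0) le le; rewrite -!expr2; lra.
  have : d ^+ 2 <= d by rewrite expr2 ger_pMr.
  lra.
have nd : nsq A * nsq (z' - z) = 4 * nsq s.
  rewrite -nsqM; have -> : A * (z' - z) = - (s + s).
    have -> : A * (z' - z) = (A * z' + b) - (A * z + b) by ring.
    by rewrite ez ez'; ring.
  by rewrite nsqN /nsq !coordE; ring.
have h : nsq A * d ^+ 2 <= 64 * S ^+ 2.
  have : nsq A * d ^+ 2 <= nsq A * (16 * nsq (z' - z)).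
    by apply: ler_wpM2l => //; exact: nsq_ge0.
  have -> : nsq A * (16 * nsq (z' - z)) = 64 * nsq s.
    have -> : nsq A * (16 * nsq (z' - z)) = 16 * (nsq A * nsq (z' - z)) by ring.
    by rewrite nd; ring.
  lra.
have T2 : 0 < T ^+ 2 by rewrite exprn_gt0.
have e : nsq A * d ^+ 2 * T ^+ 2 = nsq A.
  by rewrite -mulrA -exprMn [d * T]mulrC Td expr1n mulr1.
by have := ler_wpM2r (ltW T2) h; rewrite e.
Qed.

(** * Dynamics of the natural extension on reduced pairs *)

Definition reduced_pairs : set (C * C) :=
  [set p | conjugates s p.1 p.2 /\ reduced p.1 p.2]%classic.

(** A pair is recovered from [(A, b)]: [leading_coef_bound] bounds [A], and then [b = s - A z] is
    bounded because [|z| < 1]. *)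
Lemma finite_reduced_pairs : finite_set reduced_pairs.
Proof.
(* A bound for [|s|] that avoids a square root. *)
pose S := nsq s + 1.
have s0 := nsq_ge0 s.
have S0 : 0 <= S by rewrite /S; lra.
have sS : nsq s <= S ^+ 2 by rewrite /S; nra.
pose M := 64 * S ^+ 2 * (1 + 4 * S) ^+ 2.
(* [M] bounds [nsq A], and [2 nsq s + 2 M] bounds [nsq b] by the parallelogram law; the sum covers
   both. *)
pose M' := M + 2 * nsq s + 2 * M.
pose G := [set a : C | gauss_int a /\ nsq a <= M']%classic.
pose f (q : C * C) : C * C := ((s - q.2) / q.1, (- s - q.2) / q.1).
apply: (@sub_finite_set _ _ (f @` (G `*` G))%classic); last first.
  by apply: finite_image; apply: finite_setX; exact: finite_gauss_int.
move=> [z z'] [/= [A [b [gA A0 gb gc [ez ez']]]] rz].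
have nA : nsq A <= M := leading_coef_bound gA A0 gb gc ez ez' rz S0 sS.
have M0 : 0 <= M by apply: le_trans nA; exact: nsq_ge0.
exists (A, b); last first.
  by rewrite /f /= -ez' -{1}ez !addrK ![A * _]mulrC !mulfK.
split; split=> //=; first by rewrite /M'; lra.
have nz := in_square_nsq (let: And3 h _ _ := rz in h).
have -> : b = s - A * z by rewrite -ez addrC addKr.
have : nsq (s - A * z) <= 2 * nsq s + 2 * nsq (A * z).
  have : nsq (s - A * z) + nsq (s + A * z) = 2 * nsq s + 2 * nsq (A * z).
    by rewrite /nsq !reD !imD !reN !imN; ring.
  by have := nsq_ge0 (s + A * z); lra.
have : nsq (A * z) <= M.
  by rewrite nsqM; apply: le_trans nA; apply: ler_piMr; [exact: nsq_ge0|exact: ltW].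
rewrite /M'; lra.
Qed.

Definition natural_extension (p : C * C) : C * C :=
  (p.1^-1 - hfloor p.1^-1, p.2^-1 - hfloor p.1^-1).

Lemma reduced_pairs_inverse p : reduced_pairs p ->
  [/\ conjugates s p.1^-1 p.2^-1, coreduced p.1^-1 p.2^-1,
      hlattice (hfloor p.1^-1) & in_square (p.1^-1 - hfloor p.1^-1)].
Proof.
move=> [cp rp]; have cV := conjugatesV s_irr cp.
have rV := reducedV (proj1 (conjugates_neq0 s_irr cp)) rp.
by have [? ?] := hfloor_off_grid (off_grid_coreduced s2_int s_irr cV rV); split.
Qed.

Lemma natural_extension_reduced p :
  reduced_pairs p -> reduced_pairs (natural_extension p).
Proof.
move=> /reduced_pairs_inverse[cV rV la sq].
have cS := conjugates_sub (hlattice_gauss la) cV.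
split=> //=; apply: reduced_sub => // /(conjugates_circle s2_int s_irr cS) n1.
by have := in_square_nsq sq; rewrite n1 ltxx.
Qed.

Lemma natural_extension_inj p q : reduced_pairs p -> reduced_pairs q ->
  natural_extension p = natural_extension q -> p = q.
Proof.
move=> /reduced_pairs_inverse[_ rp lp _] /reduced_pairs_inverse[_ rq lq _] [e e'].
have [/invr_inj h1 /invr_inj h2] := coreduced_sub_inj rp rq lp lq e e'.
by case: p q h1 h2 {rp rq lp lq e e'} => [? ?] [? ?] /= -> ->.
Qed.

(** With [z = s - a] the conjugate is [- z - 2 a], and [a] is nonzero because [|s| >= 1]. So the
    distances to control are those from [- z], in the unit disk, to [2 a] and [2 a - c]. *)
Lemma reduced_pairs_start : reduced_pairs (s - hfloor s, - s - hfloor s).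
Proof.
have [la sq] := hfloor_off_grid (off_grid_start s2_int s_irr).
have c0 := conjugates_start s2_int; set a := hfloor s in la sq *.
have ns : 1 <= nsq s.
  have s20 : s ^+ 2 != 0 by rewrite expf_neq0 // s_neq0.
  have := gauss_nsq_ge1 s2_int s20; rewrite expr2 nsqM; have := nsq_ge0 s; nra.
have a0 : a != 0.
  by apply/eqP => a0; have := in_square_nsq sq; rewrite a0 subr0; lra.
have nal : nsq (- (s - a)) < 1 by rewrite nsqN; exact: in_square_nsq.
have na : 8 <= nsq (a + a).
  have -> : nsq (a + a) = 4 * nsq a by rewrite /nsq !coordE; ring.
  have : 2 <= nsq a.
    have [/eqP|/nsq_corner ->//|] := hlattice_cases la; first by rewrite (negbTE a0).
    lra.
  lra.
split; first exact/conjugates_sub/c0/hlattice_gauss.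
split=> //= [|c cc _].
  have -> : - s - a = - (s - a) - (a + a) by ring.
  by apply: nsq_sub_gt1 => //; lra.
have -> : - s - a + c = - (s - a) - (a + a - c) by ring.
have l2 : hlattice (a + a - c).
  apply: hlatticeB (corner_hlattice cc).
  have -> : a + a = a - (0 - a) by ring.
  by apply: hlatticeB => //; apply: hlatticeB => //; rewrite -(subrr a); exact: hlatticeB.
have [/subr0_eq e|cd|d4] := hlattice_cases l2.
- by move: na; rewrite e (nsq_corner cc); lra.
(* If [c] and [2 a - c] are both corners, [nsq (a + a) >= 8] and the parallelogram law force
   [a = c]; then [z' + c = - s]. *)
- have par : nsq (a - c) = 0.
    have : nsq (a + a) + nsq ((a - c) + (a - c)) = 2 * nsq c + 2 * nsq (a + a - c).
      by rewrite /nsq !coordE; ring.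
    have -> : nsq ((a - c) + (a - c)) = 4 * nsq (a - c) by rewrite /nsq !coordE; ring.
    rewrite (nsq_corner cc) (nsq_corner cd); have := nsq_ge0 (a - c); lra.
  move/eqP: par; rewrite nsq_eq0 subr_eq0 => /eqP <-.
  have -> : - (s - a) - (a + a - a) = - s by ring.
  by rewrite nsqN.
- exact/ltW/nsq_sub_gt1.
Qed.

End Finiteness.

(** Injectivity cancels common initial iterations, so any repetition yields a return to [x] itself;
    without a return the iterates would embed the naturals in [A]. *)
Lemma finite_injective_periodic (T : Type) (A : set T) (f : T -> T) (x : T) :
  finite_set A -> (forall y, A y -> A (f y)) ->
  (forall y z, A y -> A z -> f y = f z -> y = z) -> A x ->
  exists2 l, (1 <= l)%N & iter l f x = x.
Proof.
move=> finA stab inj Ax.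
have Ai n : A (iter n f x) by elim: n => //= n IH; exact: stab.
have canc i n : iter (i + n) f x = iter i f x -> iter n f x = x.
  by elim: i => //= i IH /(inj _ _ (Ai _) (Ai _)) /IH.
have [noper|] := pselect (forall n, (1 <= n)%N -> iter n f x <> x); last first.
  by move=> /existsNP[l /not_implyP[l1 /contrapT e]]; exists l.
exfalso; apply: infinite_nat.
have ginj : {in [set: nat]%classic &, injective (fun n => iter n f x)}.
  move=> i j _ _ /= e; apply/eqP; rewrite eqn_leq; apply/andP; split.
    rewrite leqNgt; apply/negP => lt; apply: (noper (i - j)%N); first by rewrite subn_gt0.
    by apply: (canc j); rewrite subnKC // ltnW.
  rewrite leqNgt; apply/negP => lt; apply: (noper (j - i)%N); first by rewrite subn_gt0.
  by apply: (canc i); rewrite subnKC // ltnW.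
rewrite -(eq_finite_set (inj_card_eq ginj)).
by apply: sub_finite_set finA => _ [n _ <-].
Qed.

Theorem theorem6p4 (R : realType) (m n : int) (s : CC R) :
  s ^+ 2 = m%:~R +i* n%:~R -> ~ gauss_rat s ->
  purely_periodic (hseq (s - hfloor s)).
Proof.
move=> s2 s_irr.
have s2_int : gauss_int (s ^+ 2) by exists m, n.
pose p0 := (s - hfloor s, - s - hfloor s).
have rp0 : reduced_pairs s p0 := reduced_pairs_start s2_int s_irr.
pose f := @natural_extension R.
have red k : reduced_pairs s (iter k f p0).
  by elim: k => //= k IH; exact: natural_extension_reduced.
(* Conjugates are never 0, so neither the terminating branch of [hseq] nor the zero branch of [TH]
   is taken. *)
have hE k : hseq (s - hfloor s) k = Some (iter k f p0).1.
  elim: k => //= k ->; have [cz _] := red k.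
  by rewrite /TH ifN ?ifN // (proj1 (conjugates_neq0 s_irr cz)).
split=> [k|]; first by rewrite hE.
have [l l1 el] := finite_injective_periodic (finite_reduced_pairs s)
  (natural_extension_reduced s2_int s_irr) (@natural_extension_inj _ _ s2_int s_irr) rp0.
by exists l => // k; rewrite !hE iterD el.
Qed.
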